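(* Let $d\in\{1,2\}$, let $K$ be any simplicial complex on $[m]$, let $H_d$ be any closed subgroup of $G_d^m$ and let $L_d=G_d^m/H_d$. Then there is an $L_d$-equivariant homotopy equivalence \[ (D^d,S^{d-1})^{K}/H_d\simeq \operatorname{hocolim}_{I\in\mathrm{cat}(K)}\ G_d^m/( G_d^I\cdot H_d), \] where $L_d$ acts on $(D^d,S^{d-1})^K/H_d$ via the $G_d^m$-action, on each $G_d^m/(G_d^I\cdot H_d)$ by left translation, and the homotopy colimit is formed in the category of $L_d$-spaces (it is an $L_d$-CW-complex with cells $\Delta^s\times G_d^m/(G_d^{I_s}\cdot H_d)$ indexed by chains $I_0\supset\dots\supset I_s$ in $\mathrm{cat}(K)$).
   Context: Let $d\in\{1,2\}$; $G_1=\{\pm1\}\cong\mathbb Z/2\mathbb Z\subset\mathbb R$, $G_2=S^1\subset\mathbb C$; $D^d$ the closed unit disk in $\mathbb R$ (resp. $\mathbb C$), $S^{d-1}=\partial D^d$. $K$ is a simplicial complex on $[m]$, $\mathrm{cat}(K)$ the poset of faces of $K$ together with $\varnothing$, ordered by inclusion. $G_d^I\subseteq G_d^m$ is the coordinate subgroup with coordinates outside $I$ equal to $1$. $(D^d,S^{d-1})^I=\prod_{i\in I}D^d\times\prod_{j\notin I}S^{d-1}$ and $(D^d,S^{d-1})^K=\bigcup_{I\in K}(D^d,S^{d-1})^I\subseteq(D^d)^m$ with coordinatewise $G_d^m$-action. $G_d^I\cdot H_d$ is the subgroup generated by $G_d^I$ and $H_d$; the diagram maps are the natural projections. *)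

(* Defs.v *)
From HB Require Import structures.
From mathcomp Require Import all_boot all_order all_algebra.
From mathcomp Require Import all_classical all_reals.
From mathcomp Require Import topology_structure product_topology function_spaces
  subspace_topology subtype_topology quotient_topology sigT_topology num_topology.
From mathcomp Require Import ring lra.
Import numFieldTopology.Exports.

Set Implicit Arguments.
Unset Strict Implicit.
Unset Printing Implicit Defensive.
Import Order.TTheory GRing.Theory Num.Theory.
Local Open Scope classical_set_scope.
Local Open Scope ring_scope.
Local Open Scope quotient_scope.

Section PolyhedralProduct.
Variables (R : realType) (d m : nat).

Local Notation C2 := (R * R)%type.
Definition cmul (z w : C2) : C2 := (z.1 * w.1 - z.2 * w.2, z.1 * w.2 + z.2 * w.1).
Definition cone : C2 := (1, 0).
Definition cconj (z : C2) : C2 := (z.1, - z.2).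

(** D^d and S^{d-1} inside C ( = R for d = 1, i.e. second coordinate 0) *)
Definition Dd : set C2 := [set z | z.1 ^+ 2 + z.2 ^+ 2 <= 1 /\ (d = 1%N -> z.2 = 0)].
Definition Sd : set C2 := [set z | z.1 ^+ 2 + z.2 ^+ 2 = 1 /\ (d = 1%N -> z.2 = 0)].

Lemma normC2_mul (z w : C2) :
  (cmul z w).1 ^+ 2 + (cmul z w).2 ^+ 2 = (z.1 ^+ 2 + z.2 ^+ 2) * (w.1 ^+ 2 + w.2 ^+ 2).
Proof. rewrite /cmul /=; ring. Qed.

Lemma Sd_mul z w : Sd z -> Sd w -> Sd (cmul z w).
Proof.
move=> [nz hz] [nw hw]; split; first by rewrite normC2_mul nz nw mulr1.
by move=> d1; rewrite /cmul /= hz // hw // !mulr0 mul0r addr0.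
Qed.

Lemma Dd_mul z w : Sd z -> Dd w -> Dd (cmul z w).
Proof.
move=> [nz hz] [nw hw]; split; first by rewrite normC2_mul nz mul1r.
by move=> d1; rewrite /cmul /= hz // hw // !mulr0 mul0r addr0.
Qed.

Local Notation V := {ptws 'I_m -> C2}.
Definition vmul (u v : V) : V := fun i => cmul (u i) (v i).
Definition vone : V := fun _ => cone.
Definition vconj (u : V) : V := fun i => cconj (u i).

Definition Gm : set V := [set u | forall i, Sd (u i)].
Local Notation GmT := (set_type Gm).

Lemma Gm_mul (g h : GmT) : vmul (val g) (val h) \in Gm.
Proof.
apply/mem_set => i; apply: Sd_mul.
- by case: g => g /set_mem /= ; apply.
- by case: h => h /set_mem /= ; apply.
Qed.

Definition mulG (g h : GmT) : GmT := @exist V (fun x => x \in Gm) _ (Gm_mul g h).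

Definition subgroup (S : set V) : Prop :=
  [/\ S `<=` Gm, S vone, (forall a b, S a -> S b -> S (vmul a b))
    & (forall a, S a -> S (vconj a))].

Definition closed_subgroup (H : set V) : Prop :=
  subgroup H /\ closed ((@set_val V Gm) @^-1` H : set GmT).

Definition GI (I : {set 'I_m}) : set V :=
  [set u | Gm u /\ forall j, j \notin I -> u j = cone].

Definition genGIH (I : {set 'I_m}) (H : set V) : set V :=
  [set a | forall S, subgroup S -> GI I `<=` S -> H `<=` S -> S a].

Definition simplicial_complex (K : {set {set 'I_m}}) : Prop :=
  forall s t : {set 'I_m}, s \in K -> t \subset s -> t \in K.

Definition catK (K : {set {set 'I_m}}) : {set {set 'I_m}} := K :|: [set finset.set0].

Definition polyprod (K : {set {set 'I_m}}) : set V :=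
  [set x | exists I, I \in catK K /\
     forall i, (i \in I -> Dd (x i)) /\ (i \notin I -> Sd (x i))].

Local Notation XKT K := (set_type (polyprod K)).

Lemma polyprod_act K (g : GmT) (x : XKT K) : vmul (val g) (val x) \in polyprod K.
Proof.
case: g => g Gg; case: x => x Xx /=; move/set_mem: Gg => Gg.
move/set_mem: Xx => [I [IK hI]]; apply/mem_set.
exists I; split => // i; split => hi.
- by apply: Dd_mul; [exact: Gg| exact: (hI i).1].
- by apply: Sd_mul; [exact: Gg| exact: (hI i).2].
Qed.

Definition actX K (g : GmT) (x : XKT K) : XKT K := @exist V (fun y => y \in polyprod K) _ (polyprod_act g x).

Section OrbitSpace.
Variables (K : {set {set 'I_m}}) (H : set V).

Definition orbX (x : XKT K) : set V := [set y | exists h, H h /\ y = vmul h (val x)].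
Definition relX' (x y : XKT K) : bool := `[< orbX x = orbX y >].

Lemma relX_refl : reflexive relX'. Proof. by move=> x; apply/asboolP. Qed.
Lemma relX_sym : symmetric relX'.
Proof. by move=> x y; apply/asboolP/asboolP => ->. Qed.
Lemma relX_trans : transitive relX'.
Proof. by move=> y x z /asboolP e1 /asboolP e2; apply/asboolP; rewrite e1 e2. Qed.

Definition relX := EquivRel _ relX_refl relX_sym relX_trans.
Definition XH := {eq_quot relX}.
HB.instance Definition _ := Topological.copy XH (quotient_topology XH).
HB.instance Definition _ := Quotient.on XH.

Definition actXH (g : GmT) (q : XH) : XH := \pi_XH (actX g (repr q)).
End OrbitSpace.

Section Homogeneous.
Variable (H : set V).

Definition cosetI (I : {set 'I_m}) (g : GmT) : set V :=
  [set b | exists a, genGIH I H a /\ b = vmul a (val g)].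
Definition relQ' I (g g' : GmT) : bool := `[< cosetI I g = cosetI I g' >].

Lemma relQ_refl I : reflexive (relQ' I). Proof. by move=> x; apply/asboolP. Qed.
Lemma relQ_sym I : symmetric (relQ' I).
Proof. by move=> x y; apply/asboolP/asboolP => ->. Qed.
Lemma relQ_trans I : transitive (relQ' I).
Proof. by move=> y x z /asboolP e1 /asboolP e2; apply/asboolP; rewrite e1 e2. Qed.

Definition relQ I := EquivRel (relQ' I) (@relQ_refl I) (@relQ_sym I) (@relQ_trans I).
Definition QI I := {eq_quot relQ I}.
HB.instance Definition _ I := Topological.copy (QI I) (quotient_topology (QI I)).
HB.instance Definition _ I := Quotient.on (QI I).

Definition actQ I (g : GmT) (q : QI I) : QI I := \pi_(QI I) (mulG g (repr q)).
Definition projQ I J (q : QI I) : QI J := \pi_(QI J) (repr q).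
End Homogeneous.


(** the homotopy colimit  hocolim_{I in cat(K)} G_d^m/(G_d^I . H):
    the quotient of the disjoint union, over all chains I_0 > I_1 > ... > I_s
    in cat(K), of the cells Delta^s x G_d^m/(G_d^{I_s} . H), by the face
    identifications.  Two points are identified iff they have the same
    non-degenerate representative: the same chain of faces carrying positive
    barycentric weight (with the same weights), and the same image of the
    group coordinate in G_d^m/(G_d^J . H), J the last face carrying positive weight. *)
Section Hocolim.
Variables (K : {set {set 'I_m}}) (H : set V).

Definition chainb (c : seq {set 'I_m}) : bool :=
  [&& c != [::], all (fun A => A \in catK K) c
    & sorted (fun A B : {set 'I_m} => B \proper A) c].

Local Notation chainT := {c : seq {set 'I_m} | chainb c}.

Local Notation Simplex n :=
  (set_type [set t : {ptws 'I_n -> R} | (forall i, 0 <= t i) /\ \sum_(i < n) t i = 1]).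

Definition Cell (c : chainT) : topologicalType :=
  (Simplex (size (val c)) * QI H (last finset.set0 (val c)))%type.

Local Notation HCpre := {c : chainT & Cell c}.

Definition nfHC (p : HCpre) : (seq ({set 'I_m} * R) * {J : {set 'I_m} & QI H J})%type :=
  let c := val (projT1 p) in
  let t := val (projT2 p).1 in
  let s := [seq (nth finset.set0 c i, t i) | i : 'I_(size c) <- enum 'I_(size c) & 0 < t i] in
  let J := last finset.set0 (map fst s) in
  (s, existT (fun J => QI H J) J (@projQ H (last finset.set0 c) J (projT2 p).2)).

Definition relHC' (p q : HCpre) : bool := `[< nfHC p = nfHC q >].
Lemma relHC_refl : reflexive relHC'. Proof. by move=> x; apply/asboolP. Qed.
Lemma relHC_sym : symmetric relHC'.
Proof. by move=> x y; apply/asboolP/asboolP => ->. Qed.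
Lemma relHC_trans : transitive relHC'.
Proof. by move=> y x z /asboolP e1 /asboolP e2; apply/asboolP; rewrite e1 e2. Qed.

Definition relHC := EquivRel _ relHC_refl relHC_sym relHC_trans.
Definition HC := {eq_quot relHC}.
HB.instance Definition _ := Topological.copy HC (quotient_topology HC).
HB.instance Definition _ := Quotient.on HC.

(** G_d^m acts (through L_d = G_d^m/H) by left translation on the group coordinate *)
Definition actHC (g : GmT) (p : HC) : HC :=
  let r := repr p in
  \pi_HC (existT Cell (projT1 r) ((projT2 r).1, @actQ H _ g (projT2 r).2)).
End Hocolim.

End PolyhedralProduct.

Section Equivariant.
Variables (R : realType) (Gt : Type).

Local Notation UI := (set_type [set t : R | 0 <= t <= 1]).

Definition equivariant (A B : Type) (actA : Gt -> A -> A) (actB : Gt -> B -> B)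
  (f : A -> B) : Prop := forall g x, f (actA g x) = actB g (f x).

Definition equiv_homotopic (A B : topologicalType) (actA : Gt -> A -> A)
  (actB : Gt -> B -> B) (f0 f1 : A -> B) : Prop :=
  exists F : (A * UI)%type -> B,
    [/\ continuous F,
        (forall t : UI, equivariant actA actB (fun x => F (x, t))),
        (forall (x : A) (t : UI), val t = 0 -> F (x, t) = f0 x)
      & (forall (x : A) (t : UI), val t = 1 -> F (x, t) = f1 x)].

Definition equiv_homotopy_equivalent (A B : topologicalType)
  (actA : Gt -> A -> A) (actB : Gt -> B -> B) : Prop :=
  exists (f : A -> B) (g : B -> A),
    [/\ continuous f /\ continuous g,
        equivariant actA actB f /\ equivariant actB actA g,
        equiv_homotopic actA actA (g \o f) idfun
      & equiv_homotopic actB actB (f \o g) idfun].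
End Equivariant.

(* Main.v *)
(* The orbit space is equivariantly homeomorphic to the homotopy colimit, so both homotopies can
   be taken constant.  A point of the cell of a chain I_0 > ... > I_s with weights t and group
   coordinate u is sent to the class of (r_i u_i)_i, where r_i is the total weight of the sets
   I_k not containing i.  The order complex of cat(K) thereby triangulates the set of vectors of
   absolute values of points of (D^d,S^{d-1})^K: the chain and the positive weights are recovered
   from r, and the last set of positive weight is the zero set of r, so that G_d^I for this I is
   the stabiliser of the point. *)
Require Import Defs.
From HB Require Import structures.
From mathcomp Require Import all_boot all_order all_algebra.
From mathcomp Require Import all_classical all_reals.
From mathcomp Require Import topology_structure product_topology function_spaces
  subspace_topology subtype_topology quotient_topology sigT_topology num_topology.
From mathcomp Require Import topology normedtype ring lra.
Import numFieldTopology.Exports numFieldNormedType.Exports.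
Import Order.TTheory GRing.Theory Num.Theory.
Local Open Scope classical_set_scope.
Local Open Scope ring_scope.
Local Open Scope quotient_scope.
Set Implicit Arguments.
Unset Strict Implicit.
Unset Printing Implicit Defensive.


(** * Decreasing chains of sets with positive weights, and the radii they define *)

Section WeightedChains.
Context {R : realType} {m : nat}.
Implicit Types (s : seq ({set 'I_m} * R)) (r : 'I_m -> R) (T : R) (i : 'I_m).

(* The absolute value of the i-th coordinate at the point with barycentric coordinates s. *)
Definition coradius s i : R := \sum_(p <- s | i \notin p.1) p.2.

Definition mass s : R := \sum_(p <- s) p.2.

Definition descending : rel {set 'I_m} := fun A B => B \proper A.

(** Strict positivity is what makes a chain recoverable from its radii. The total mass is left free,
    not fixed to 1, so that inductions can pass to tails. *)
Definition wchain s := sorted descending (map fst s) && all (fun p => 0 < p.2) s.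

Lemma descending_trans : transitive descending.
Proof. by move=> B A C BA CB; exact: proper_trans CB BA. Qed.

Lemma wchain_cons p s : wchain (p :: s) ->
  [/\ 0 < p.2, wchain s & forall q, q \in s -> q.1 \proper p.1].
Proof.
rewrite /wchain /= => /andP[ps /andP[p0 s0]]; split => //.
  by rewrite s0 (path_sorted ps).
move=> q qs; have /allP := order_path_min descending_trans ps.
by apply; apply: map_f.
Qed.

Lemma mass_ge0 s : wchain s -> 0 <= mass s.
Proof.
move=> /andP[_ /allP s0]; rewrite /mass big_seq_cond sumr_ge0// => p.
by rewrite andbT => /s0/ltW.
Qed.

Lemma mass_eq0 s : wchain s -> mass s = 0 -> s = [::].
Proof.
case: s => // p s /wchain_cons[p0 /mass_ge0 s0 _].
by rewrite /mass big_cons => /eqP; rewrite gt_eqF // ltr_pwDl.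
Qed.

Lemma coradius_ge0 s i : wchain s -> 0 <= coradius s i.
Proof.
move=> /andP[_ /allP s0]; rewrite /coradius big_seq_cond sumr_ge0// => p.
by move=> /andP[/s0/ltW].
Qed.

Lemma coradius_le s i : wchain s -> coradius s i <= mass s.
Proof.
move=> /andP[_ /allP s0]; rewrite /coradius /mass.
rewrite big_seq_cond [leRHS]big_seq_cond big_mkcondl [leRHS]big_mkcondl/=.
rewrite big_mkcond/=; apply: ler_sum => p _.
by case: ifPn; case: ifPn => // /s0/ltW.
Qed.

Lemma coradius_cons p s i :
  coradius (p :: s) i = (if i \notin p.1 then p.2 else 0) + coradius s i.
Proof. by rewrite /coradius big_cons; case: ifP => _ //; rewrite add0r. Qed.

(** The later sets lie inside the head, so an index missing from the head is missing from all of
    them and collects every weight. *)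
Lemma coradius_notin p s i : wchain (p :: s) -> i \notin p.1 ->
  coradius (p :: s) i = mass (p :: s).
Proof.
move=> /wchain_cons[_ _ sp] ip; rewrite coradius_cons ip /mass big_cons.
congr (_ + _); rewrite /coradius big_seq_cond [RHS]big_seq.
apply: eq_bigl => q; case qs: (q \in s) => //=.
by apply: contra ip; apply/fintype.subsetP/proper_sub/sp.
Qed.

Lemma coradius_in (p : {set 'I_m} * R) s i : i \in p.1 -> coradius (p :: s) i = coradius s i.
Proof. by move=> ip; rewrite coradius_cons ip add0r. Qed.

(** This recovers the head set from the radii: an index in the head loses the positive head weight,
    while any other index attains the full mass. *)
Lemma head_wchain p s i : wchain (p :: s) ->
  (i \in p.1) = (coradius (p :: s) i < mass (p :: s)).
Proof.
move=> ps; have [p0 ws _] := wchain_cons ps.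
have [ip|ip] := boolP (i \in p.1); last by rewrite coradius_notin ?ltxx.
rewrite coradius_in// /mass big_cons; symmetry.
by rewrite ltr_pwDl// coradius_le.
Qed.

(** An index of [p.1] outside the head of [s1] has [coradius s1] equal to the full mass of [s1],
    while [coradius s2] never exceeds the mass of [s2]. Applied in both directions, this shows that
    two tails have equal mass. *)
Lemma mass_tail_le p s1 s2 : wchain (p :: s1) -> wchain s2 ->
  {in p.1, coradius s1 =1 coradius s2} -> mass s1 <= mass s2.
Proof.
move=> /wchain_cons[_ ws1 s1p] ws2 e; case: s1 => [|q s1] in ws1 s1p e *.
  by rewrite [leLHS]/mass big_nil mass_ge0.
have /properP[_ [i ip iq]] := s1p q (mem_head _ _).
by rewrite -(coradius_notin ws1 iq) e// coradius_le.
Qed.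

(** The head is peeled off: its set is the locus of non-maximal radius, and its weight is the total
    mass minus the mass of the tail. *)
Lemma wchain_inj s1 s2 : wchain s1 -> wchain s2 -> mass s1 = mass s2 ->
  coradius s1 =1 coradius s2 -> s1 = s2.
Proof.
elim: s1 s2 => [|p1 s1 IH] [|p2 s2] // ws1 ws2 em ec.
- by rewrite (mass_eq0 ws2)// -em /mass big_nil.
- by rewrite (mass_eq0 ws1)// em /mass big_nil.
have e1 : p1.1 = p2.1.
  by apply/setP => i; rewrite (head_wchain _ ws1) (head_wchain _ ws2) ec em.
have es : {in p1.1, coradius s1 =1 coradius s2}.
  move=> i ip; rewrite -(coradius_in s1 ip) ec coradius_in//.
  by rewrite -e1.
have [_ w1 _] := wchain_cons ws1; have [_ w2 _] := wchain_cons ws2.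
have ems : mass s1 = mass s2.
  apply/eqP; rewrite eq_le (mass_tail_le ws1)//= (mass_tail_le ws2)// => i ip.
  by rewrite es// e1.
have e2 : p1.2 = p2.2.
  by move: em; rewrite /mass !big_cons; move: ems; rewrite /mass => -> /addIr.
rewrite (surjective_pairing p1) (surjective_pairing p2) e1 e2.
congr (_ :: _); apply: IH => // i.
by apply: (@addrI _ (if i \notin p1.1 then p1.2 else 0));
  rewrite {2}e1 {2}e2 -!coradius_cons.
Qed.

(** All weights are positive, so the radius vanishes exactly at indices lying in every set, that is,
    in the smallest one. *)
Lemma mem_last_wchain s i : wchain s -> s != [::] ->
  (i \in last finset.set0 (map fst s)) = (coradius s i == 0).
Proof.
elim: s => // p [_ ws _|q s IH ws _].
  have [p0 _ _] := wchain_cons ws; rewrite coradius_cons /coradius big_nil addr0 /=.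
  by case: ifPn => [/negbTE->|/negPn->]; rewrite ?eqxx// gt_eqF.
have [p0 ws' /(_ q (mem_head _ _))/properP[/fintype.subsetP qp _]] := wchain_cons ws.
rewrite [last _ _]/= -[last q.1 _]/(last finset.set0 (map fst (q :: s))) IH//.
rewrite [in RHS]coradius_cons; have [ip|ip] := boolP (i \in p.1); first by rewrite /= add0r.
have iq : i \notin q.1 by apply: contra ip; exact: qp.
have c0 := coradius_ge0 i ws'.
have [q0 _ _] := wchain_cons ws'.
have c1 : 0 < coradius (q :: s) i.
  rewrite coradius_notin// /mass big_cons ltr_pwDl// mass_ge0//.
  by case: (wchain_cons ws').
by rewrite !gt_eqF// addr_gt0.
Qed.

(* The top set is the locus where r is not maximal; truncating r at its next value
   leaves the rest of the chain. *)
Lemma wchain_exists r T : 0 < T -> (forall i, 0 <= r i <= T) ->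
  exists s, [/\ wchain s, mass s = T & coradius s =1 r].
Proof.
have [n] := ubnP #|[set i | r i < T]%SET|.
elim: n r T => // n IH r T; rewrite ltnS => nr T0 rT.
pose I := [set i | r i < T]%SET.
have rI i : (i \in I) = (r i < T) by rewrite inE.
have rT' i : i \notin I -> r i = T.
  by rewrite rI -leNgt => Tr; apply/eqP; rewrite eq_le Tr; have /andP[_ ->] := rT i.
(* If [r] takes no value strictly between 0 and [T], a chain with one set suffices. *)
have [r0|] := pselect (forall i, i \in I -> r i = 0).
  exists [:: (I, T)]; split.
  - by rewrite /wchain/= T0.
  - by rewrite /mass big_seq1.
  - move=> i; rewrite coradius_cons /coradius big_nil addr0/=.
    by have [/r0|/rT'] := boolP (i \in I).
move=> /existsNP[i0 /not_implyP[i0I /eqP r0]].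
pose i1 := [arg max_(i > i0 in I) r i]%O.
have [i1I i1max] : i1 \in I /\ forall i, i \in I -> r i <= r i1.
  by rewrite /i1; case: arg_maxP.
have T1 : 0 < r i1.
  rewrite (lt_le_trans _ (i1max _ i0I))// lt_def r0.
  by case/andP: (rT i0).
pose r' i := Num.min (r i) (r i1).
have r'I i : i \in I -> r' i = r i by move=> iI; rewrite /r' min_l ?i1max.
have r'nI i : i \notin I -> r' i = r i1.
  by move=> iI; rewrite /r' min_r// (rT' _ iI); case/andP: (rT i1).
(* After truncation [i1] has maximal radius and leaves the top set, so the induction measure
   drops. *)
have sub : ([set i | r' i < r i1] \proper I)%SET.
  apply/properP; split; last by exists i1; rewrite // inE r'I// ltxx.
  apply/fintype.subsetP => i; rewrite inE; apply: contraTT => /r'nI ->.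
  by rewrite ltxx.
have [||s [ws ms cs]] := IH r' (r i1) _ T1.
- exact: leq_trans (proper_card sub) nr.
- move=> i; rewrite /r' ge_min lexx orbT andbT le_min (ltW T1) andbT.
  by case/andP: (rT i).
case: s => [|q s] in ws ms cs *.
  by move: T1; rewrite -ms /mass big_nil ltxx.
have qE : q.1 = [set i | r' i < r i1]%SET.
  by apply/setP => i; rewrite (head_wchain _ ws) ms cs inE.
exists ((I, T - r i1) :: q :: s); split.
- case/andP: ws => sq aq; rewrite /wchain/= in sq aq *; rewrite sq aq !andbT.
  by rewrite subr_gt0 -rI i1I andbT /descending qE.
- by rewrite /mass big_cons -/(mass _) ms/= subrK.
- move=> i; rewrite coradius_cons cs/=; have [iI|iI] := boolP (i \in I).
    by rewrite add0r r'I.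
  by rewrite r'nI// subrK rT'.
Qed.

End WeightedChains.

(** * Complex arithmetic, polar decomposition and coordinatewise products *)

Section Algebra.
Context {R : realType}.
Implicit Types (z w v : (R * R)%type).

Lemma cmulC z w : cmul z w = cmul w z.
Proof. by rewrite /cmul; congr pair; ring. Qed.

Lemma cmulA z w v : cmul z (cmul w v) = cmul (cmul z w) v.
Proof. by rewrite /cmul /=; congr pair; ring. Qed.

Lemma cmul1 z : cmul (cone R) z = z.
Proof. by case: z => a b; rewrite /cmul /=; congr pair; ring. Qed.

Lemma Sd_cconj d z : Sd d z -> Sd d (cconj z).
Proof. by move=> [nz hz]; split => /=; [rewrite sqrrN|move=> /hz ->; rewrite oppr0]. Qed.

Lemma cmul_conj d z : Sd d z -> cmul (cconj z) z = cone R.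
Proof. by move=> [nz _]; rewrite /cmul /cone /= -nz; congr pair; ring. Qed.

Lemma Sd_cone d : Sd d (cone R).
Proof. by split=> //=; rewrite expr1n expr0n addr0. Qed.

Definition cscale (a : R) z : R * R := (a * z.1, a * z.2).

Lemma cmul_scale z a w : cmul z (cscale a w) = cscale a (cmul z w).
Proof. by rewrite /cmul /cscale /=; congr pair; ring. Qed.

Lemma cscale1 z : cscale 1 z = z.
Proof. by case: z => a b; rewrite /cscale /= !mul1r. Qed.

Lemma cscaleK a z w : a != 0 -> cscale a z = cscale a w -> z = w.
Proof. by case: z w => [a1 a2] [b1 b2] a0 [] /(mulfI a0) -> /(mulfI a0) ->. Qed.

Lemma Dd_scale d a z : 0 <= a <= 1 -> Sd d z -> Dd d (cscale a z).
Proof.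
move=> /andP[a0 a1] [nz hz]; split => /=; last by move=> /hz ->; rewrite mulr0.
by rewrite !exprMn -mulrDr nz mulr1 expr_le1.
Qed.

Definition cnorm z : R := Num.sqrt (z.1 ^+ 2 + z.2 ^+ 2).

Lemma cnorm_scale d a z : 0 <= a -> Sd d z -> cnorm (cscale a z) = a.
Proof.
by move=> a0 [nz _]; rewrite /cnorm /= !exprMn -mulrDr nz mulr1 sqrtr_sqr ger0_norm.
Qed.

Lemma cnorm_mul d z w : Sd d z -> cnorm (cmul z w) = cnorm w.
Proof. by move=> [nz _]; rewrite /cnorm normC2_mul nz mul1r. Qed.

Lemma cnorm_Dd d z : Dd d z -> cnorm z <= 1.
Proof. by move=> [nz _]; rewrite -sqrtr1 ler_sqrt. Qed.

Lemma cnorm_Sd d z : Sd d z -> cnorm z = 1.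
Proof. by move=> [nz _]; rewrite /cnorm nz sqrtr1. Qed.

Lemma polar d z : Dd d z -> exists2 u, Sd d u & z = cscale (cnorm z) u.
Proof.
move=> [_ hz]; have [z0|z0] := eqVneq (cnorm z) 0.
  (* The origin has no preferred direction; 1 serves as a default for both values of [d]. *)
  exists (cone R); first exact: Sd_cone.
  move/eqP: z0; rewrite sqrtr_eq0 => z0.
  have [z1 z2] := (sqr_ge0 z.1, sqr_ge0 z.2).
  have /eqP : z.1 ^+ 2 = 0 by lra.
  have /eqP : z.2 ^+ 2 = 0 by lra.
  rewrite !sqrf_eq0 /cnorm => /eqP e2 /eqP e1.
  by rewrite [LHS]surjective_pairing e1 e2 expr0n addr0 sqrtr0 /cscale !mul0r.
exists (cscale (cnorm z)^-1 z); last first.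
  by rewrite /cscale /= !mulrA divff// !mul1r -surjective_pairing.
split=> /=; last by move=> /hz ->; rewrite mulr0.
rewrite !exprMn -mulrDr -[X in _ * X]sqr_sqrtr ?addr_ge0 ?sqr_ge0//.
by rewrite -exprMn mulVf// expr1n.
Qed.

Context {m : nat}.
Local Notation V := {ptws 'I_m -> (R * R)%type}.
Implicit Types (a b u x : V).

Lemma vmulC a b : vmul a b = vmul b a.
Proof. by apply/funext => i; exact: cmulC. Qed.

Lemma vmulA a b u : vmul a (vmul b u) = vmul (vmul a b) u.
Proof. by apply/funext => i; exact: cmulA. Qed.

Lemma vmulCA a b u : vmul a (vmul b u) = vmul b (vmul a u).
Proof. by rewrite vmulA (vmulC a) -vmulA. Qed.

Lemma vmul1 a : vmul (@vone R m) a = a.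
Proof. by apply/funext => i; exact: cmul1. Qed.

Lemma vmulV d a : Gm d a -> vmul (vconj a) a = @vone R m.
Proof. by move=> Ga; apply/funext => i; exact: cmul_conj (Ga i). Qed.

Lemma vconj_mul a b : vconj (vmul a b) = vmul (vconj a) (vconj b).
Proof. by apply/funext => i; rewrite /vconj /vmul /cconj /cmul /=; congr pair; ring. Qed.

Lemma vconjK d a u : Gm d a -> vmul (vconj a) (vmul a u) = u.
Proof. by move=> Ga; rewrite vmulA (vmulV Ga) vmul1. Qed.

Lemma Gm_conj d a : Gm d a -> Gm d (vconj a).
Proof. by move=> Ga i; exact: Sd_cconj (Ga i). Qed.

Definition vscale (r : 'I_m -> R) u : V := fun i => cscale (r i) (u i).

Lemma vmul_scale a r u : vmul a (vscale r u) = vscale r (vmul a u).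
Proof. by apply/funext => i; exact: cmul_scale. Qed.

End Algebra.

(** * Coordinate subgroups, generated subgroups and their cosets *)

Section Subgroups.
Context {R : realType} {m : nat} (d : nat).
Local Notation V := {ptws 'I_m -> (R * R)%type}.
Local Notation GmT := (set_type (@Gm R d m)).
Implicit Types (H : set V) (I J : {set 'I_m}) (a b u : V).

Lemma valG (g : GmT) : Gm d (val g).
Proof. exact: set_mem (valP g). Qed.

Lemma Gm_subgroup : subgroup d (@Gm R d m).
Proof.
split=> //; first by move=> i; exact: Sd_cone.
- by move=> a b Ga Gb i; exact: Sd_mul (Ga i) (Gb i).
- by move=> a; exact: Gm_conj.
Qed.

Lemma GI_subgroup I : subgroup d (@GI R d m I).
Proof.
split.
- by move=> a [].
- by split=> [i|//]; exact: Sd_cone.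
- move=> a b [Ga Ia] [Gb Ib]; split=> [i|i iI]; first exact: Sd_mul (Ga i) (Gb i).
  by rewrite /vmul Ia// Ib// cmul1.
- move=> a [Ga Ia]; split=> [|i iI]; first exact: Gm_conj.
  by rewrite /vconj Ia// /cconj /cone /= oppr0.
Qed.

Lemma GI_sub I J : I \subset J -> GI d I `<=` @GI R d m J.
Proof.
move=> IJ a [Ga Ia]; split=> // j jJ; apply: Ia; apply: contra jJ.
exact/fintype.subsetP.
Qed.

Lemma genGIH_subgroup I H : subgroup d H -> subgroup d (genGIH d I H).
Proof.
move=> sH; split.
- by move=> a; apply; [exact: Gm_subgroup|move=> b []|case: sH].
- by move=> S [].
- move=> a b Ha Hb S sS IS HS; have [_ _ SM _] := sS.
  by apply: SM; [exact: Ha|exact: Hb].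
- move=> a Ha S sS IS HS; have [_ _ _ SV] := sS.
  by apply: SV; exact: Ha.
Qed.

Lemma genGIH_GI I H : GI d I `<=` genGIH d I H.
Proof. by move=> a Ia S _ IS _; exact: IS. Qed.

Lemma genGIH_H I H : H `<=` genGIH d I H.
Proof. by move=> a Ha S _ _ HS; exact: HS. Qed.

Lemma genGIH_sub I J H : I \subset J -> genGIH d I H `<=` genGIH d J H.
Proof.
move=> IJ a aI S sS JS HS; apply: aI => //.
exact: subset_trans (GI_sub IJ) JS.
Qed.

(** By commutativity the products of an element of [GI d I] and one of [H] already form a subgroup,
    which contains both factors. *)
Lemma genGIHP I H a : subgroup d H -> genGIH d I H a ->
  exists b h, [/\ GI d I b, H h & a = vmul b h].
Proof.
move=> sH; have [HG H1 HM HV] := sH; have [IG I1 IM IV] := GI_subgroup I.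
move=> /(_ [set a | exists b h, [/\ GI d I b, H h & a = vmul b h]]); apply.
- split.
  + move=> _ [b [h [Ib Hh ->]]] i; apply: Sd_mul.
      by have := IG _ Ib; exact.
    by have := HG _ Hh; exact.
  + by exists (@vone R m), (@vone R m); split=> //; rewrite vmul1.
  + move=> _ _ [b [h [Ib Hh ->]]] [b' [h' [Ib' Hh' ->]]].
    exists (vmul b b'), (vmul h h'); split; [exact: IM|exact: HM|].
    by rewrite -!vmulA [vmul h (vmul b' h')]vmulCA.
  + move=> _ [b [h [Ib Hh ->]]]; exists (vconj b), (vconj h).
    by split; [exact: IV|exact: HV|exact: vconj_mul].
- by move=> b Ib; exists b, (@vone R m); split=> //; rewrite vmulC vmul1.
- by move=> h Hh; exists (@vone R m), h; split=> //; rewrite vmul1.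
Qed.

(** Both quotient relations compare orbits as sets; this turns such an equality into a single
    translating element. *)
Lemma coset_eqP (S : set V) a b : subgroup d S ->
  [set y | exists s, S s /\ y = vmul s a] = [set y | exists s, S s /\ y = vmul s b] <->
  exists2 s, S s & a = vmul s b.
Proof.
move=> [SG S1 SM SV]; split=> [e|[s Ss ->]].
  have : [set y | exists s, S s /\ y = vmul s a] a by exists (@vone R m); rewrite vmul1.
  by rewrite e => -[s [Ss ->]]; exists s.
apply/seteqP; split=> _ [t [St ->]].
  by exists (vmul t s); split; [exact: SM|rewrite vmulA].
exists (vmul t (vconj s)); split; first by apply: SM => //; exact: SV.
by rewrite -vmulA (vconjK _ (SG _ Ss)).
Qed.

Context (H : set V) (sH : subgroup d H).

Lemma piQ_eq I (g g' : GmT) : \pi_(QI d H I) g = \pi_(QI d H I) g' <->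
  exists2 a, genGIH d I H a & val g = vmul a (val g').
Proof.
rewrite -(coset_eqP _ _ (genGIH_subgroup I sH)); split=> [/eqquotP/asboolP//|e].
by apply/eqquotP/asboolP.
Qed.

(** Controls the arbitrary choice made by [repr], on which the projections and actions of the
    diagram are built. *)
Lemma repr_piQ I (g : GmT) : exists2 a, genGIH d I H a &
  val (repr (\pi_(QI d H I) g)) = vmul a (val g).
Proof. by apply/piQ_eq; rewrite reprK. Qed.

Context (K : {set {set 'I_m}}).
Local Notation XKT := (set_type (@polyprod R d m K)).

Lemma piX_eq (x y : XKT) : \pi_(XH d K H) x = \pi_(XH d K H) y <->
  exists2 h, H h & val x = vmul h (val y).
Proof.
rewrite -(coset_eqP _ _ sH); split=> [/eqquotP/asboolP//|e].
by apply/eqquotP/asboolP.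
Qed.

End Subgroups.

(** * Continuity, compactness and separation for the spaces involved *)

Section Topology.

Lemma continuous_ptws {I : eqType} {T U : topologicalType} (f : T -> {ptws I -> U}) :
  (forall i, continuous (fun x => f x i)) -> continuous f.
Proof.
move=> cf x; apply/cvg_sup => i; apply/cvg_image.
  by rewrite eqEsubset; split=> // y _; exists (fun=> y).
move=> W /=; rewrite nbhs_simpl => /(cf i x); rewrite nbhs_simpl => Wx.
exists ((fun g => g i) @^-1` W) => //.
by rewrite eqEsubset; split=> [y [g + <-]//|y Wy]; exists (fun=> y).
Qed.

Lemma continuous_proj {I : eqType} {U : topologicalType} (i : I) :
  continuous (fun f : {ptws I -> U} => f i).
Proof. exact: (@proj_continuous I (fun=> U) i). Qed.

Lemma continuous_val {X : topologicalType} (A : set X) :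
  continuous (val : set_type A -> X).
Proof. exact: initial_continuous. Qed.

Lemma continuous_set_type {X T : topologicalType} (A : set X) (f : T -> set_type A) :
  continuous (val \o f) -> continuous f.
Proof. exact: (@continuous_comp_initial _ _ _ set_val). Qed.

(** A filter on the subtype is pushed forward to [X], where it clusters at a point of [A]; that
    point is then lifted back. *)
Lemma compact_set_type {X : topologicalType} (A : set X) :
  compact A -> compact [set: set_type A].
Proof.
move=> cA F FF FT.
have FA : F (set_val @^-1` A).
  by apply: filterS FT => y _; exact: set_valP.
have [p [Ap clp]] := cA (set_val @ F) _ FA.
exists (exist _ p (mem_set Ap)); split=> // B C FB [_ [[W oW <-] Wp WC]].
have [||x [[y By <-] Wx]] := clp (set_val @` B) W.
- by apply: (@filterS _ F _ B) => // y By; exists y.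
- by apply: open_nbhs_nbhs; split.
- by exists y; split=> //; exact: WC.
Qed.

Lemma hausdorff_set_type {X : topologicalType} (A : set X) :
  hausdorff_space X -> hausdorff_space (set_type A).
Proof.
move=> hX p q clpq; apply/val_inj/hX => B C Bp Cq.
have [x [Bx Cx]] := clpq _ _ (continuous_val Bp) (continuous_val Cq).
by exists (val x).
Qed.

Context {R : realType}.

Lemma continuous_mulr {T : topologicalType} (f g : T -> R) :
  continuous f -> continuous g -> continuous (fun x => f x * g x).
Proof. by move=> cf cg x; exact: cvgM (cf x) (cg x). Qed.

Lemma continuous_addr {T : topologicalType} (f g : T -> R) :
  continuous f -> continuous g -> continuous (fun x => f x + g x).
Proof. by move=> cf cg x; exact: cvgD (cf x) (cg x). Qed.

Lemma continuous_sum {T : topologicalType} (I : Type) (r : seq I) (P : pred I)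
    (f : I -> T -> R) : (forall i, P i -> continuous (f i)) ->
  continuous (fun x => \sum_(i <- r | P i) f i x).
Proof. by apply: continuous_big; exact: add_continuous. Qed.

Lemma continuous_subr {T : topologicalType} (f g : T -> R) :
  continuous f -> continuous g -> continuous (fun x => f x - g x).
Proof. by move=> cf cg x; exact: cvgB (cf x) (cg x). Qed.

Lemma continuous_fst {X Y : topologicalType} : continuous (@fst X Y).
Proof. by move=> x; exact: cvg_fst. Qed.

Lemma continuous_snd {X Y : topologicalType} : continuous (@snd X Y).
Proof. by move=> x; exact: cvg_snd. Qed.

Lemma continuous_pair {T X Y : topologicalType} (f : T -> X) (g : T -> Y) :
  continuous f -> continuous g -> continuous (fun x => (f x, g x)).
Proof. by move=> cf cg x; apply: cvg_pair; [exact: cf|exact: cg]. Qed.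

Lemma continuous_compose {X Y Z : topologicalType} (f : X -> Y) (g : Y -> Z) :
  continuous f -> continuous g -> continuous (g \o f).
Proof. by move=> cf cg x; exact: continuous_comp (cf x) (cg (f x)). Qed.

Lemma continuous_cscale {T : topologicalType} (a : T -> R) (z : T -> (R * R)%type) :
  continuous a -> continuous z -> continuous (fun x => cscale (a x) (z x)).
Proof.
move=> ca cz; apply: continuous_pair; apply: continuous_mulr => //.
- exact: continuous_compose cz continuous_fst.
- exact: continuous_compose cz continuous_snd.
Qed.

Lemma continuous_cmul (z : R * R) : continuous (cmul z).
Proof.
by apply: continuous_pair; [apply: continuous_subr|apply: continuous_addr];
  apply: continuous_mulr; do ?[exact: continuous_fst|exact: continuous_snd|exact: cst_continuous].
Qed.

Lemma compact_Sd d : compact (@Sd R d).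
Proof.
have cI := @segment_compact R (-1) 1.
apply: (subclosed_compact _ (compact_setX cI cI)).
- have cn : continuous (fun z : R * R => z.1 ^+ 2 + z.2 ^+ 2).
    by apply: continuous_addr; apply: continuous_mulr;
      do ?[exact: continuous_fst|exact: continuous_snd].
  rewrite (_ : Sd d = (fun z : R * R => z.1 ^+ 2 + z.2 ^+ 2) @^-1` [set 1]
     `&` [set z | d = 1%N -> z.2 = 0]); last by apply/seteqP; split.
  apply: closedI.
    by apply: preimage_closed => //; exact: closed_eq.
  (* The condition on the second coordinate is vacuous unless [d] is 1, in which case it is the
     closed condition that this coordinate vanishes. *)
  have [d1|d1] := pselect (d = 1%N); last first.
    rewrite (_ : [set _ | _] = setT); first exact: closedT.
    by apply/seteqP; split=> // z _ /d1.
  rewrite (_ : [set _ | _] = (@snd R R) @^-1` [set 0]).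
    by apply: preimage_closed; [move=> z _; exact: continuous_snd|exact: closed_eq].
  by apply/seteqP; split=> z //= /(_ d1).
- move=> z [nz _]; have [z1 z2] := (sqr_ge0 z.1, sqr_ge0 z.2).
  split=> /=; rewrite in_itv/= -ler_norml -(@ler_pXn2r _ 2)// ?nnegrE//.
    by rewrite expr1n real_normK ?num_real//; lra.
  by rewrite expr1n real_normK ?num_real//; lra.
Qed.

Context {m : nat}.
Local Notation V := {ptws 'I_m -> (R * R)%type}.

Lemma hausdorff_V : hausdorff_space V.
Proof.
apply: (@hausdorff_product _ (fun=> (R * R)%type)) => _ p q clpq.
(* A continuous real function takes the same value at two points without disjoint neighbourhoods;
   the two projections then give [p = q]. *)
have h f : continuous f -> f p = f q :> R.
  move=> cf; apply: Rhausdorff => B C /cf Bp /cf Cq.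
  by have [x [Bx Cx]] := clpq _ _ Bp Cq; exists (f x).
rewrite [p]surjective_pairing [q]surjective_pairing; congr pair.
  by apply: h; exact: continuous_fst.
by apply: h; exact: continuous_snd.
Qed.

Lemma compact_Gm d : compact (@Gm R d m).
Proof. by apply: (@tychonoff _ (fun=> (R * R)%type) (fun=> Sd d)) => _; exact: compact_Sd. Qed.

Definition simplex n : set {ptws 'I_n -> R} :=
  [set t | (forall i, 0 <= t i) /\ \sum_(i < n) t i = 1].

Lemma compact_simplex n : compact (@simplex n).
Proof.
rewrite (_ : @simplex n = [set t : {ptws 'I_n -> R} | forall i, `[0, 1]%classic (t i)]
   `&` (fun t : {ptws 'I_n -> R} => \sum_(i < n) t i) @^-1` [set 1]).
  apply: compact_closedI.
    by apply: (@tychonoff _ (fun=> R) (fun=> `[0, 1]%classic)) => _; exact: segment_compact.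
  apply: preimage_closed; last exact: closed_eq.
  by move=> t _; apply: continuous_sum => i _; exact: continuous_proj.
apply/seteqP; split=> [t [t0 t1]|t [t0 t1]]; split=> // i.
  rewrite /= in_itv/= t0/= -t1 (bigD1 i)//= lerDl sumr_ge0// => j _.
by have := t0 i; rewrite /= in_itv/= => /andP[].
Qed.

End Topology.

(** * Barycentric coordinates on a closed simplex and their positive part *)

Section Barycentric.
Context {R : realType} {m : nat}.
Implicit Types (c : seq {set 'I_m}) (i : 'I_m).

Lemma last_sub_mem c A : sorted descending c -> A \in c ->
  last finset.set0 c \subset A.
Proof.
case: c => // B c; rewrite [sorted _ _]/= [last _ _]/=.
elim: c A B => [|C c IH] A B /=; first by rewrite inE => _ /eqP->.
move=> /andP[CB cc]; rewrite inE => /predU1P[->|]; last exact: IH.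
by apply: fintype.subset_trans (proper_sub CB); apply: IH; rewrite ?mem_head.
Qed.

(** The counterpart of [coradius] on the whole closed simplex: vanishing weights are kept, which
    makes continuity in [t] evident. *)
Definition bary c (t : 'I_(size c) -> R) i : R :=
  \sum_(k < size c | i \notin nth finset.set0 c k) t k.

(** Spelled as in [nfHC], so that the first component of a normal form is convertible to it. *)
Definition positive_part c (t : 'I_(size c) -> R) : seq ({set 'I_m} * R) :=
  [seq (nth finset.set0 c k, t k) | k : 'I_(size c) <- enum 'I_(size c) & 0 < t k].

Lemma positive_part_subseq c t : subseq (map fst (@positive_part c t)) c.
Proof.
rewrite -map_comp -[X in subseq _ X](mkseq_nth finset.set0) /mkseq -val_enum_ord.
rewrite -[X in subseq _ X]map_comp; apply: map_subseq.
exact: filter_subseq.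
Qed.

Lemma wchain_positive_part c t : sorted descending c -> wchain (@positive_part c t).
Proof.
move=> sc; rewrite /wchain (subseq_sorted descending_trans (positive_part_subseq t) sc).
by apply/allP => _ /mapP[k + ->]; rewrite mem_filter => /andP[].
Qed.

Lemma coradius_positive_part c t i : (forall k, 0 <= t k) ->
  coradius (@positive_part c t) i = bary t i.
Proof.
move=> t0; rewrite /coradius big_map big_filter_cond big_enum_cond/=.
rewrite /bary [RHS](bigID (fun k => 0 < t k))/=.
rewrite [X in _ = _ + X]big1 ?addr0.
  by apply: eq_bigl => k; rewrite andbC.
by move=> k /andP[_]; rewrite -leNgt => tk; apply/eqP; rewrite eq_le tk t0.
Qed.

Lemma mass_positive_part c t : (forall k, 0 <= t k) ->
  mass (@positive_part c t) = \sum_(k < size c) t k.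
Proof.
move=> t0; rewrite /mass big_map big_filter big_enum_cond/=.
rewrite [RHS](bigID (fun k => 0 < t k))/= [X in _ = _ + X]big1 ?addr0//.
by move=> k; rewrite -leNgt => tk; apply/eqP; rewrite eq_le tk t0.
Qed.

(** The index type uses [size (map fst s)], not [size s], because the cell containing these weights
    is that of the chain [map fst s]. *)
Definition weights (s : seq ({set 'I_m} * R)) : {ptws 'I_(size (map fst s)) -> R} :=
  fun k => (nth (finset.set0, 0) s k).2.

Lemma bary_weights s i : bary (@weights s) i = coradius s i.
Proof.
rewrite /bary /coradius (big_nth (finset.set0, 0)).
rewrite -(big_mkord (fun k => i \notin nth finset.set0 (map fst s) k)
  (fun k => (nth (finset.set0, 0) s k).2)) size_map.
rewrite big_nat_cond [RHS]big_nat_cond; apply: eq_bigl => k.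
have [ks|] := boolP (0 <= k < size s)%N => //=.
by rewrite (nth_map (finset.set0, 0)).
Qed.

Lemma sum_weights s : \sum_k @weights s k = mass s.
Proof.
rewrite /mass (big_nth (finset.set0, 0)).
by rewrite -(big_mkord xpredT (fun k => (nth (finset.set0, 0) s k).2)) size_map.
Qed.

Lemma weights_ge0 s k : wchain s -> 0 <= @weights s k.
Proof.
move=> /andP[_ /allP s0]; apply/ltW/s0/mem_nth.
by rewrite -(size_map fst) ltn_ord.
Qed.

Lemma continuous_bary c i :
  continuous (fun t : {ptws 'I_(size c) -> R} => bary t i).
Proof. by apply: continuous_sum => k _; exact: continuous_proj. Qed.

End Barycentric.

(** * The comparison bijection, its continuity in both directions and its equivariance *)

Section Comparison.
Context {R : realType} {d m : nat} (K : {set {set 'I_m}}).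
Context (H : set {ptws 'I_m -> (R * R)%type}).
Context (simplicialK : simplicial_complex K) (subgroupH : subgroup d H).
Local Notation V := {ptws 'I_m -> (R * R)%type}.
Local Notation GmT := (set_type (@Gm R d m)).
Local Notation XKT := (set_type (@polyprod R d m K)).
Local Notation chainT := {c : seq {set 'I_m} | chainb K c}.
Local Notation HCpre := {c : chainT & Cell d H c}.
Local Notation Simplex n := (set_type (@simplex R n)).
Implicit Types (c : chainT) (p : HCpre).

Lemma chain_sorted c : sorted descending (val c).
Proof. by case: c => c /= /and3P[]. Qed.

Lemma simplex_ge0 n (t : Simplex n) k : 0 <= val t k.
Proof. by case: (set_mem (valP t)). Qed.

Lemma wchain_simplex c (t : Simplex (size (val c))) :
  [/\ wchain (positive_part (val t)), mass (positive_part (val t)) = 1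
    & positive_part (val t) != [::]].
Proof.
have w := wchain_positive_part (val t) (chain_sorted c).
have m1 : mass (positive_part (val t)) = 1.
  by rewrite mass_positive_part; [case: (set_mem (valP t))|exact: simplex_ge0].
split=> //; apply/eqP => s0; move: m1; rewrite s0 /mass big_nil => /eqP.
by rewrite eq_sym oner_eq0.
Qed.

Lemma bary_positive_part c (t : Simplex (size (val c))) :
  bary (val t) =1 coradius (positive_part (val t)).
Proof. by move=> i; rewrite coradius_positive_part//; exact: simplex_ge0. Qed.

Lemma bary_ge0 c (t : Simplex (size (val c))) i : 0 <= bary (val t) i.
Proof. by rewrite bary_positive_part coradius_ge0//; case: (wchain_simplex t). Qed.

Lemma polyprod_scale c (t : Simplex (size (val c))) (u : GmT) :
  vscale (bary (val t)) (val u) \in @polyprod R d m K.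
Proof.
have [w m1] := wchain_simplex t; have := @bary_positive_part c t.
have := positive_part_subseq (val t); case: positive_part w m1 => // q s w m1 sub b _.
(* The witness is the first set of positive weight: off it every radius is 1, on it at most 1. *)
apply/mem_set; exists q.1; split.
  have := valP c => /and3P[_ /allP + _]; apply.
  by apply: (mem_subseq sub); rewrite mem_head.
move=> i; split=> iq; rewrite /vscale b.
  apply: Dd_scale; last exact: (valG u).
  by rewrite coradius_ge0// -m1 coradius_le.
by rewrite coradius_notin// m1 cscale1; exact: (valG u).
Qed.

Definition cellpt c (tu : Simplex (size (val c)) * GmT) : XKT :=
  @exist V (fun y => y \in polyprod d K) _ (polyprod_scale tu.1 tu.2).

(** Depends on a chosen coset representative, so only its class modulo [H] is meaningful. Continuity
    is argued through [cellpt] and [precell], which take an actual group element. *)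
Definition repr_point p : XKT := cellpt ((projT2 p).1, repr (projT2 p).2).

Definition precell c (tu : Simplex (size (val c)) * GmT) : HCpre :=
  existT (Cell d H) c (tu.1, \pi_(QI d H _) tu.2).

Lemma bary_last c (t : Simplex (size (val c))) i :
  (i \in last finset.set0 (map fst (positive_part (val t)))) = (bary (val t) i == 0).
Proof. by have [? _ ?] := wchain_simplex t; rewrite mem_last_wchain// bary_positive_part. Qed.

Lemma last_sub_positive_part c (t : Simplex (size (val c))) :
  last finset.set0 (val c) \subset last finset.set0 (map fst (positive_part (val t))).
Proof.
apply: last_sub_mem (chain_sorted c) _; apply: (mem_subseq (positive_part_subseq (val t))).
have [_ _] := wchain_simplex t; case: positive_part => //= q s _.
exact: mem_last.
Qed.

(** The radii vanish on [J], so the factor in [GI d J] fixes the scaled vector and only the factor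
    in [H] is seen. *)
Lemma vscale_genGIH c (t : Simplex (size (val c)))
    (J := last finset.set0 (map fst (positive_part (val t)))) a (u v : V) :
  genGIH d J H a -> u = vmul a v ->
  exists2 h, H h & vscale (bary (val t)) u = vmul h (vscale (bary (val t)) v).
Proof.
move=> /(genGIHP subgroupH)[b [h [[Gb Jb] Hh ->]]] ->; exists h => //.
rewrite -!vmulA vmul_scale; apply/funext => i; rewrite /vscale.
have [iJ|iJ] := boolP (i \in J).
  by move: iJ; rewrite bary_last => /eqP ->; rewrite /cscale !mul0r.
by rewrite {1}/vmul Jb// cmul1.
Qed.

Lemma repr_point_precell c tu : \pi_(XH d K H) (repr_point (precell tu)) = \pi_(XH d K H) (@cellpt c tu).
Proof.
apply/(piX_eq subgroupH); have [a aI e] := repr_piQ subgroupH (last finset.set0 (val c)) tu.2.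
exact: vscale_genGIH (genGIH_sub (last_sub_positive_part tu.1) aI) e.
Qed.

Definition lastface p := last finset.set0 (map fst (positive_part (val (projT2 p).1))).

Lemma piHC_eq p p' : \pi_(HC d K H) p = \pi_(HC d K H) p' <->
  positive_part (val (projT2 p).1) = positive_part (val (projT2 p').1) /\
  exists2 a, genGIH d (lastface p) H a &
    val (repr (projT2 p).2) = vmul a (val (repr (projT2 p').2)).
Proof.
have sJ J := genGIH_subgroup J subgroupH.
split=> [/eqquotP/asboolP e|[e1 [a aJ e2]]]; last first.
  apply/eqquotP/asboolP; rewrite /nfHC; congr pair; first exact: e1.
  rewrite /projQ -/(lastface p) -/(lastface p').
  have <- : lastface p = lastface p' by rewrite /lastface e1.
  by congr existT; apply/(piQ_eq subgroupH); exists a.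
have e1 : positive_part (val (projT2 p).1) = positive_part (val (projT2 p').1).
  by have /= e1 := congr1 (fun z => z.1) e; exact: e1.
split=> //; have eJ : lastface p = lastface p' by rewrite /lastface e1.
(* Sending each dependent pair to its coset, a plain subset of [V], avoids transporting along the
   equality of the indices [J]. *)
pose f (z : {J & QI d H J}) : set V := cosetI H (projT1 z) (repr (projT2 z)).
move/(congr1 (f \o snd)): e; rewrite /f /= /projQ -/(lastface p) -/(lastface p') -eJ.
move=> /(coset_eqP _ _ (sJ _)) [a aJ].
have [b bJ ->] := repr_piQ subgroupH (lastface p) (repr (projT2 p).2).
have [b' bJ' ->] := repr_piQ subgroupH (lastface p) (repr (projT2 p').2).
have [SG _ SM SV] := sJ (lastface p).
move=> e; exists (vmul (vconj b) (vmul a b')); first exact: SM (SV _ bJ) (SM _ _ aJ bJ').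
by rewrite -!vmulA -e (vconjK _ (SG _ bJ)).
Qed.

(** The two implications say that the comparison map is well defined and that it is injective. *)
Lemma repr_point_inj p p' : \pi_(HC d K H) p = \pi_(HC d K H) p' <->
  \pi_(XH d K H) (repr_point p) = \pi_(XH d K H) (repr_point p').
Proof.
rewrite piHC_eq (piX_eq subgroupH); split=> [[e1 [a aJ e2]]|[h Hh e]].
  have [h Hh e] := vscale_genGIH aJ e2; exists h => //; rewrite [LHS]e.
  congr vmul; apply/funext => i; congr cscale.
  by rewrite [LHS]bary_positive_part [RHS]bary_positive_part e1.
have HG : Gm d h by case: subgroupH => HG _ _ _; exact: HG.
(* Elements of [H] have coordinates of modulus 1, so the moduli of the coordinates determine the
   radii, and these determine the weighted chain. *)
have eb : bary (val (projT2 p).1) =1 bary (val (projT2 p').1).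
  move=> i; have := congr1 (fun x : V => cnorm (x i)) e.
  rewrite [RHS](cnorm_mul _ (HG i)) /= /vscale.
  by rewrite !(cnorm_scale _ (valG _ _)) ?bary_ge0.
have e1 : positive_part (val (projT2 p).1) = positive_part (val (projT2 p').1).
  have [w m1 _] := wchain_simplex (projT2 p).1.
  have [w' m1' _] := wchain_simplex (projT2 p').1.
  apply: wchain_inj => //; first by rewrite m1 m1'.
  by move=> i; rewrite -!bary_positive_part eb.
split=> //.
set u := val (repr (projT2 p).2) in e *; set u' := val (repr (projT2 p').2) in e *.
have Gu : Gm d u by exact: valG.
have Gu' : Gm d u' by exact: valG.
pose b := vmul u (vmul (vconj h) (vconj u')).
have [_ _ GM GV] := @Gm_subgroup R m d.
(* The element [b] measures how far [u] is from [h] times [u']. These agree wherever the radius is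
   nonzero, so [b] is 1 off the last face and lies in its coordinate subgroup. *)
have ub : u = vmul (vmul b h) u'.
  rewrite /b -!vmulA (vmulCA (vconj u')) (vconjK _ HG).
  by rewrite (vmulV Gu') vmulC vmul1.
exists (vmul b h) => //.
have [_ _ SM _] := genGIH_subgroup (lastface p) subgroupH.
apply: SM; last exact: genGIH_H.
apply: genGIH_GI; split; first exact: GM Gu (GM _ _ (GV _ HG) (GV _ Gu')).
move=> j; rewrite /lastface bary_last => j0.
have : u j = vmul h u' j.
  apply: (cscaleK j0); have := congr1 (fun x : V => x j) e.
  by rewrite /= vmul_scale /vscale -eb.
rewrite /b /vmul => ->; rewrite cmulA [cmul (cmul _ _) (vconj h j)]cmulC.
by rewrite cmulA (cmul_conj (HG j)) cmul1 cmulC (cmul_conj (Gu' j)).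
Qed.

(** Polar decomposition gives the group coordinate, and [wchain_exists] applied to the moduli gives
    the chain and its weights. *)
Lemma repr_point_surj (x : XKT) : exists c tu, @cellpt c tu = x.
Proof.
have [I [IK xI]] := set_mem (valP x).
have xD i : Dd d (val x i).
  have [iI|iI] := boolP (i \in I); first exact: (xI i).1.
  by have [nx hx] := (xI i).2 iI; split=> //; rewrite nx.
pose u : V := fun i => s2val (cid2 (polar (xD i))).
have Gu : u \in @Gm R d m by apply/mem_set => i; rewrite /u; case: cid2.
have xu i : val x i = cscale (cnorm (val x i)) (u i) by rewrite /u; case: cid2.
have [||s [ws ms cs]] := @wchain_exists R m (fun i => cnorm (val x i)) 1.
- exact: ltr01.
- by move=> i; rewrite sqrtr_ge0/=; exact: cnorm_Dd (xD i).
(* The head is the set of coordinates of modulus below 1, hence inside [I]; all other sets are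
   smaller, and [catK K] is closed under subsets. *)
have sI q : q \in s -> q.1 \in catK K.
  case: s => // q0 s in ws ms cs * => qs.
  have q0I : q0.1 \subset I.
    apply/fintype.subsetP => i; rewrite (head_wchain _ ws) ms cs.
    by apply: contraTT => iI; rewrite (cnorm_Sd ((xI i).2 iI)) ltxx.
  have qI : q.1 \subset I.
    move: qs; rewrite inE => /predU1P[->//|qs].
    have [_ _ /(_ q qs)/proper_sub qq0] := wchain_cons ws.
    exact: fintype.subset_trans qq0 q0I.
  move: IK; rewrite !inE => /orP[IK|/eqP I0]; first by rewrite (simplicialK IK).
  by rewrite -finset.subset0 -I0 qI orbT.
have cc : chainb K (map fst s).
  rewrite /chainb; case/andP: (ws) => -> _; rewrite andbT; apply/andP; split.
    by case: s ms {ws cs sI} => //; rewrite /mass big_nil => /eqP; rewrite eq_sym oner_eq0.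
  by apply/allP => _ /mapP[q /sI + ->].
have ts : @weights R m s \in @simplex R (size (map fst s)).
  by apply/mem_set; split=> [k|]; [exact: weights_ge0|rewrite sum_weights].
exists (exist (fun A => chainb K A) _ cc).
exists (exist (fun t => t \in @simplex R _) _ ts, exist (fun a : V => a \in @Gm R d m) _ Gu).
apply: val_inj; apply/funext => i; rewrite /= /vscale bary_weights cs.
by rewrite -xu.
Qed.

(** A strictly decreasing chain is determined by the set of its members, and there are finitely many
    such sets. *)
Lemma finite_chains : finite_set [set: chainT].
Proof.
pose f c := [set x in val c]%SET.
have fI : injective f.
  move=> c c' e; apply: val_inj.
  apply: (irr_sorted_eq descending_trans _ (chain_sorted c) (chain_sorted c')).
    by move=> A; rewrite /descending fintype.properxx.
  by move=> A; have := congr1 (fun S : {set {set 'I_m}} => A \in S) e; rewrite !inE.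
have -> : [set: chainT] = f @^-1` setT by [].
by apply: finite_preimage => [c c' _ _ /fI//|]; exact: finite_finset.
Qed.

(** The saturation of [B] is the union of its preimages under translations by elements of the
    subgroup, each of which is continuous. *)
Lemma open_piQ I (B : set GmT) : open B -> open (\pi_(QI d H I) @` B).
Proof.
move=> oB; rewrite /open/= /quotient_open.
rewrite (_ : _ @^-1` _ = \bigcup_(a in [set a : GmT | genGIH d I H (val a)]) (mulG a @^-1` B)).
  apply: bigcup_open => a _; apply: open_comp oB => + _.
  apply: continuous_set_type; apply: continuous_ptws => i.
  have cval : continuous (fun g : GmT => val g i).
    exact: continuous_compose (@continuous_val V _) (@continuous_proj 'I_m (R * R)%type i).
  exact: continuous_compose cval (@continuous_cmul R (val a i)).
have [SG _ _ SV] := genGIH_subgroup I subgroupH.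
apply/seteqP; split=> [g [b Bb /(piQ_eq subgroupH)[a aI e]]|g [a aI Bg]].
  have aG := mem_set (SG _ aI).
  exists (exist (fun a : V => a \in @Gm R d m) _ aG) => //=.
  by rewrite (_ : mulG _ _ = b)//; apply: val_inj; rewrite e.
by exists (mulG a g) => //; apply/(piQ_eq subgroupH); exists (val a).
Qed.

Lemma continuous_cellpt c : continuous (@cellpt c).
Proof.
apply: continuous_set_type; apply: continuous_ptws => i.
have cb : continuous (fun t : Simplex (size (val c)) => bary (val t) i).
  exact: continuous_compose (@continuous_val _ _) (@continuous_bary R m (val c) i).
have cu : continuous (fun u : GmT => val u i).
  exact: continuous_compose (@continuous_val V _) (@continuous_proj 'I_m (R * R)%type i).
have cb1 := continuous_compose (@continuous_fst _ GmT) cb.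
have cu2 := continuous_compose (@continuous_snd (Simplex (size (val c))) _) cu.
exact: continuous_cscale cb1 cu2.
Qed.

Lemma continuous_precell c : continuous (@precell c).
Proof.
apply: (continuous_compose _ (existT_continuous (X := Cell d H) c)).
apply: continuous_pair; first exact: continuous_fst.
exact: continuous_compose continuous_snd (@pi_continuous _ (QI d H _)).
Qed.

Definition hocolim_orbit (q : HC d K H) : XH d K H := \pi_(XH d K H) (repr_point (repr q)).

Lemma hocolim_orbitE p : hocolim_orbit (\pi_(HC d K H) p) = \pi_(XH d K H) (repr_point p).
Proof. by apply/repr_point_inj; rewrite reprK. Qed.

Lemma hocolim_orbit_inj : injective hocolim_orbit.
Proof. by move=> q q' /repr_point_inj; rewrite !reprK. Qed.

Lemma continuous_hocolim_orbit : continuous hocolim_orbit.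
Proof.
apply/quotient_continuous.
pose F c (tq : Cell d H c) := \pi_(XH d K H) (repr_point (existT (Cell d H) c tq)).
rewrite (_ : _ \o _ = fun p => F (projT1 p) (projT2 p)); last first.
  by apply/funext => -[c tq]; exact: hocolim_orbitE.
apply: (@sigT_continuous _ (Cell d H) _ F) => c [t q] W.
(* Continuity is clear before the group coordinate is passed to its quotient. A product
   neighbourhood found there descends because the quotient map of the group is open. *)
have cp : continuous (fun tu => \pi_(XH d K H) (@cellpt c tu)).
  exact: continuous_compose (@continuous_cellpt c) (@pi_continuous _ (XH d K H)).
move=> /(cp (t, repr q))[[A B] [/= At Bq] AB].
move: Bq; rewrite nbhsE => -[B' [oB' B'q] B'B].
exists (A, \pi_(QI d H _) @` B') => /=.
  split=> //; apply: open_nbhs_nbhs; split; first exact: open_piQ.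
  by exists (repr q); rewrite ?reprK.
move=> [s _] [/= As [u B'u <-]]; rewrite /F (repr_point_precell (s, u)).
by apply: (AB (s, u)); split=> //; exact: B'B.
Qed.

Lemma hocolim_orbit_surj (q : XH d K H) : exists z, hocolim_orbit z = q.
Proof.
have [c [tu e]] := repr_point_surj (repr q).
exists (\pi_(HC d K H) (precell tu)).
by rewrite hocolim_orbitE repr_point_precell e reprK.
Qed.

Definition orbit_hocolim (q : XH d K H) : HC d K H := sval (cid (hocolim_orbit_surj q)).

Lemma orbit_hocolimK : cancel orbit_hocolim hocolim_orbit.
Proof. by move=> q; rewrite /orbit_hocolim; case: cid. Qed.

Lemma hocolim_orbitK : cancel hocolim_orbit orbit_hocolim.
Proof. by move=> q; apply: hocolim_orbit_inj; rewrite orbit_hocolimK. Qed.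

(* Finitely many compact spaces [Simplex * G_d^m] jointly surject onto the Hausdorff space
   (D^d,S^{d-1})^K, which therefore carries the quotient topology. *)
Lemma continuous_orbit_hocolim : continuous orbit_hocolim.
Proof.
apply/quotient_continuous.
pose P c : topologicalType := (Simplex (size (val c)) * GmT)%type.
pose F (z : {c & P c}) : XKT := cellpt (projT2 z).
pose G (z : {c & P c}) : HC d K H := \pi_(HC d K H) (precell (projT2 z)).
have cF : continuous F.
  exact: (@sigT_continuous _ P _ _ continuous_cellpt).
have cG : continuous G.
  apply: (@sigT_continuous _ P _ (fun c tu => \pi_(HC d K H) (@precell c tu))) => c.
  exact: continuous_compose (@continuous_precell c) (@pi_continuous _ (HC d K H)).
(* On the cells the inverse becomes [G], which is visibly continuous, although the inverse itself
   was obtained by choice. *)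
have GF z : orbit_hocolim (\pi_(XH d K H) (F z)) = G z.
  case: z => c tu; apply: hocolim_orbit_inj.
  by rewrite orbit_hocolimK hocolim_orbitE repr_point_precell.
have cP : compact [set: {c & P c}].
  apply: sigT_compact; first exact: finite_chains.
  move=> c; rewrite -setXTT; apply: compact_setX; apply: compact_set_type.
    exact: compact_simplex.
  exact: compact_Gm.
apply/continuous_closedP => A cA.
(* Written this way, the preimage is a continuous image of a closed subset of a compact space: it is
   compact, hence closed. *)
rewrite (_ : _ @^-1` A = F @` (G @^-1` A)); last first.
  apply/seteqP; split=> [x /= Ax|_ [p Ap <-]]; last by rewrite /= GF.
  have [c [tu e]] := repr_point_surj x; exists (existT P c tu); last exact: e.
  by rewrite /preimage /= -GF (_ : F _ = x).
apply: compact_closed; first exact/hausdorff_set_type/hausdorff_V.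
apply: continuous_compact; first exact: continuous_subspaceT.
apply: (subclosed_compact _ cP) => //.
by apply: preimage_closed => // x _; exact: cG.
Qed.

Lemma hocolim_orbit_equivariant :
  equivariant (@actHC R d m K H) (@actXH R d m K H) hocolim_orbit.
Proof.
move=> g q; rewrite /actHC hocolim_orbitE /hocolim_orbit /actXH.
case: (repr q) => c [t u]; rewrite /actQ.
rewrite (repr_point_precell (t, mulG g (repr u))).
set x := repr_point _.
have : \pi_(XH d K H) (repr (\pi_(XH d K H) x)) = \pi_(XH d K H) x by rewrite reprK.
move=> /(piX_eq subgroupH)[h Hh e].
have [_ _ _ HV] := subgroupH; have HG : Gm d h by case: subgroupH => HG _ _ _; exact: HG.
(* [actXH] acts on a chosen representative, which is [h] times [x]; by commutativity the factor [h]
   moves past [g] and is cancelled by its conjugate. *)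
apply/(piX_eq subgroupH); exists (vconj h); first exact: HV.
by rewrite /= e vmulCA (vconjK _ HG) -vmul_scale.
Qed.

End Comparison.

(* Theorem 3.3: for d in {1,2}, a simplicial complex K on [m] and a closed
   subgroup H of G_d^m, there is an L_d = G_d^m/H - equivariant homotopy
   equivalence  (D^d,S^{d-1})^K / H  ~  hocolim_{I in cat(K)} G_d^m/(G_d^I . H). *)
Theorem theorem3p3 (R : realType) (d m : nat) (K : {set {set 'I_m}})
    (H : set {ptws 'I_m -> (R * R)%type}) :
  (d = 1%N \/ d = 2%N) ->
  simplicial_complex K ->
  closed_subgroup d H ->
  equiv_homotopy_equivalent R (@actXH R d m K H) (@actHC R d m K H).
Proof.
move=> _ sK [sH _]; exists (orbit_hocolim sK sH), (@hocolim_orbit _ _ _ K H).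
have eq_g := @hocolim_orbit_equivariant _ _ _ K _ sH.
split.
- by split; [exact: continuous_orbit_hocolim|exact: continuous_hocolim_orbit].
(* The inverse of an equivariant bijection is equivariant. *)
- split=> // g q; apply: (hocolim_orbit_inj sH).
  by rewrite eq_g !orbit_hocolimK.
- exists fst; split=> //; first exact: continuous_fst.
  by move=> q t _; rewrite /= orbit_hocolimK.
- exists fst; split=> //; first exact: continuous_fst.
  by move=> q t _; rewrite /= hocolim_orbitK.
Qed.
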